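(* Let $n\in\mathbb N$. The underlying normed space of $\widehat M_n$ is $\mathbb T_n$, the space of $n\times n$ complex matrices with the trace norm; that is, under the identification $M_1(\widehat M_n)=M_n$, the norm of $a\in M_1(\widehat M_n)$ equals its trace norm $\|a\|_t$.
   Context: All linear spaces are complex. $M_n$ is the linear space of $n\times n$ complex matrices; $\|\cdot\|_o$ and $\|\cdot\|_t$ are the operator norm and the trace (trace class) norm on it. For a linear space $E$, $M_n(E)$ is the space of $n\times n$ matrices with entries in $E$; $u\oplus w$ denotes the block-diagonal matrix with blocks $u,w$. The closed unit ball of a normed space $X$ is $B_X$. A matrix-norm on $E$ is a sequence of norms $\|\cdot\|_n$ on $M_n(E)$, $n\in\mathbb N$, such that (Axiom 1) $\|u\oplus 0\|_{n+m}=\|u\|_n$ for $u\in M_n(E)$ and $0\in M_m(E)$; (Axiom 2) $\|Su\|_n\le\|S\|_o\|u\|_n$ and $\|uS\|_n\le\|u\|_n\|S\|_o$ for $u\in M_n(E)$, $S\in M_n$. A matricially normed space is a linear space with a matrix-norm; its underlying normed space is $E$ with the norm of $M_1(E)=E$. For a linear operator $\varphi:E\to F$, its $m$-th amplification is $\varphi_m:M_m(E)\to M_m(F)$, $(x_{ij})\mapsto(\varphi(x_{ij}))$. The space $\widehat M_n$: for a linear space $E$ and $v=(x_{ij})\in M_n(E)$ let $\varphi^v:M_n\to E$, $(\lambda_{ij})\mapsto\sum_{i,j}\lambda_{ji}x_{ij}$. $\widehat M_n$ is $M_n$ with the matrix-norm given on $u\in M_m(M_n)$ by $\|u\|_m:=\sup\|(\varphi^v)_m(u)\|_m$,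 the supremum taken over all pairs $(E,v)$ with $E$ a matricially normed space and $v\in B_{M_n(E)}$. *)

(* Defs.v *)
(* The complex numbers are R[i], for R any model [R : realType] of the reals. *)
From HB Require Import structures.
From mathcomp Require Import all_boot all_order all_algebra.
From mathcomp Require Import complex.
From mathcomp Require Import classical_sets reals constructive_ereal ereal.

Set Implicit Arguments.
Unset Strict Implicit.
Unset Printing Implicit Defensive.

Import Order.TTheory GRing.Theory Num.Theory.

Local Open Scope classical_set_scope.
Local Open Scope ring_scope.

Definition cabs (R : realType) (z : R[i]) : R := complex.Re `|z|.

Definition l2norm (R : realType) (n : nat) (x : 'cV[R[i]]_n) : R :=
  Num.sqrt (\sum_(i < n) cabs (x i 0) ^+ 2).

Definition opnorm (R : realType) (n : nat) (S : 'M[R[i]]_n) : R :=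
  sup [set r : R | exists x : 'cV[R[i]]_n,
                     l2norm x <= 1 /\ r = l2norm (S *m x)].

(* The trace of |a| = (a^* a)^(1/2), i.e. the sum of the singular values of a:
   [spectral_diag] lists, with multiplicity, the eigenvalues of the Hermitian
   matrix a^* a, which are nonnegative reals. *)
Definition trnorm (R : realType) (n : nat) (a : 'M[R[i]]_n) : R :=
  \sum_(i < n)
    Num.sqrt (complex.Re (spectral_diag (map_mx Num.conj a^T *m a) 0 i)).

Section ModuleMatrices.
Variables (C : pzRingType) (E : lmodType C).

Definition mxscale (n : nat) (c : C) (u : 'M[E]_n) : 'M[E]_n :=
  \matrix_(i, j) (c *: u i j).

Definition lact (n : nat) (S : 'M[C]_n) (u : 'M[E]_n) : 'M[E]_n :=
  \matrix_(i, j) \sum_(k < n) S i k *: u k j.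

Definition ract (n : nat) (u : 'M[E]_n) (S : 'M[C]_n) : 'M[E]_n :=
  \matrix_(i, j) \sum_(k < n) S k j *: u i k.

End ModuleMatrices.

(* The index n = 0 is harmless: M_0(E) = 0, so [mxnorm] vanishes there and the
   axioms involving it hold automatically. *)
Record matNormedSpace (R : realType) := MatNormedSpace {
  mns_sort :> lmodType R[i];
  mxnorm : forall n : nat, 'M[mns_sort]_n -> R;
  mxnorm_ge0 : forall (n : nat) (u : 'M[mns_sort]_n), 0 <= mxnorm u;
  mxnorm_eq0 : forall (n : nat) (u : 'M[mns_sort]_n), mxnorm u = 0 -> u = 0;
  mxnormD : forall (n : nat) (u w : 'M[mns_sort]_n),
    mxnorm (u + w) <= mxnorm u + mxnorm w;
  mxnormZ : forall (n : nat) (c : R[i]) (u : 'M[mns_sort]_n),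
    mxnorm (mxscale c u) = cabs c * mxnorm u;
  mxnorm_dsum0 : forall (n m : nat) (u : 'M[mns_sort]_n),
    mxnorm (block_mx u 0 0 (0 : 'M[mns_sort]_m)) = mxnorm u;
  mxnorm_lact : forall (n : nat) (S : 'M[R[i]]_n) (u : 'M[mns_sort]_n),
    mxnorm (lact S u) <= opnorm S * mxnorm u;
  mxnorm_ract : forall (n : nat) (u : 'M[mns_sort]_n) (S : 'M[R[i]]_n),
    mxnorm (ract u S) <= mxnorm u * opnorm S
}.

Definition amplification (E F : Type) (phi : E -> F) (m : nat)
  (u : 'M[E]_m) : 'M[F]_m := map_mx phi u.

(* Note the transposed index in [a j i]. *)
Definition mxfun (C : pzRingType) (E : lmodType C) (n : nat) (v : 'M[E]_n)
  (a : 'M[C]_n) : E := \sum_(i < n) \sum_(j < n) a j i *: v i j.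

(* The supremum is taken in the extended reals, so that an equality with a real
   number also asserts that it is finite. *)
Definition hatnorm (R : realType) (n m : nat) (u : 'M['M[R[i]]_n]_m) : \bar R :=
  ereal_sup [set r : \bar R |
    exists (E : matNormedSpace R) (v : 'M[E]_n),
      mxnorm v <= 1 /\ r = (mxnorm (amplification (mxfun v) u))%:E].

(* Main.v *)
(* If a = W D P with P unitary, W a partial isometry and D the diagonal matrix of
   the singular values of a, then phi^v(a) = "tr(a v)" is the combination, with
   the singular values as coefficients, of the diagonal entries of P v W; by the
   axioms these entries have norm at most 1 when v does.  The bound is attained
   for E = C with the operator norms and v = P^* W^*. *)
Require Import Defs.
From mathcomp Require Import all_boot all_order all_algebra.
From mathcomp Require Import complex.
From mathcomp Require Import classical_sets reals constructive_ereal ereal.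
From mathcomp Require Import ring lra.

Set Implicit Arguments.
Unset Strict Implicit.
Unset Printing Implicit Defensive.

Import Order.TTheory GRing.Theory Num.Theory.

Local Open Scope ring_scope.

Local Notation "A ^t*" := (map_mx Num.conj A^T) : ring_scope.

(** * Modulus of complex numbers and Euclidean norm of column vectors *)

Section EuclideanNorm.
Variable R : realType.
Implicit Types (z : R[i]) (n : nat).

Lemma real_cabs z : (cabs z)%:C%C = `|z|.
Proof. by rewrite RRe_real ?normr_real. Qed.

Lemma cabs_ge0 z : 0 <= cabs z.
Proof. by rewrite -ler0c real_cabs normr_ge0. Qed.

Lemma cabsM z1 z2 : cabs (z1 * z2) = cabs z1 * cabs z2.
Proof. by apply: complexI; rewrite rmorphM /= !real_cabs normrM. Qed.

Lemma cabsD z1 z2 : cabs (z1 + z2) <= cabs z1 + cabs z2.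
Proof. by rewrite -lecR rmorphD /= !real_cabs ler_normD. Qed.

Lemma cabs0 : cabs (0 : R[i]) = 0.
Proof. by apply: complexI; rewrite real_cabs normr0. Qed.

Lemma cabs0_eq0 z : cabs z = 0 -> z = 0.
Proof. by move=> z0; apply/normr0_eq0; rewrite -real_cabs z0. Qed.

Lemma cabs_real (r : R) : 0 <= r -> cabs r%:C%C = r.
Proof. by move=> r0; apply: complexI; rewrite real_cabs ger0_norm ?ler0c. Qed.

Lemma l2norm_ge0 n (x : 'cV[R[i]]_n) : 0 <= l2norm x.
Proof. exact: sqrtr_ge0. Qed.

Lemma sqr_l2norm n (x : 'cV[R[i]]_n) :
  l2norm x ^+ 2 = \sum_(i < n) cabs (x i 0) ^+ 2.
Proof. by rewrite sqr_sqrtr // sumr_ge0 // => i _; exact: sqr_ge0. Qed.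

Lemma l2norm0 n : l2norm (0 : 'cV[R[i]]_n) = 0.
Proof.
apply/eqP; rewrite -sqrf_eq0 sqr_l2norm big1 // => i _.
by rewrite mxE cabs0 expr0n.
Qed.

Lemma cabs_le_l2norm n (x : 'cV[R[i]]_n) i : cabs (x i 0) <= l2norm x.
Proof.
rewrite -ler_sqr ?nnegrE ?cabs_ge0 ?l2norm_ge0 // sqr_l2norm.
by rewrite (bigD1 i) //= lerDl sumr_ge0 // => j _; exact: sqr_ge0.
Qed.

Lemma l2norm_eq0 n (x : 'cV[R[i]]_n) : l2norm x = 0 -> x = 0.
Proof.
move=> x0; apply/matrixP => i j; rewrite ord1 mxE; apply: cabs0_eq0.
by apply/eqP; rewrite eq_le cabs_ge0 andbT -x0 cabs_le_l2norm.
Qed.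

Lemma l2normZ n z (x : 'cV[R[i]]_n) : l2norm (z *: x) = cabs z * l2norm x.
Proof.
apply/eqP; rewrite -(@eqrXn2 _ 2) ?mulr_ge0 ?cabs_ge0 ?l2norm_ge0 //.
rewrite exprMn !sqr_l2norm mulr_sumr; apply/eqP; apply: eq_bigr => i _.
by rewrite mxE cabsM exprMn.
Qed.

Lemma l2normD n (x y : 'cV[R[i]]_n) : l2norm (x + y) <= l2norm x + l2norm y.
Proof.
(* Zero vectors are treated apart: the Cauchy-Schwarz bound [CS] is reached by cancelling the factor
   [l2norm x * l2norm y]. *)
have [/l2norm_eq0 -> | x0] := eqVneq (l2norm x) 0.
  by rewrite l2norm0 !add0r.
have [/l2norm_eq0 -> | y0] := eqVneq (l2norm y) 0.
  by rewrite l2norm0 !addr0.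
have xgt0 : 0 < l2norm x by rewrite lt_def x0 l2norm_ge0.
have ygt0 : 0 < l2norm y by rewrite lt_def y0 l2norm_ge0.
set p := \sum_(i < n) cabs (x i 0) * cabs (y i 0).
have CS : p <= l2norm x * l2norm y.
  (* Expanded, this sum of squares is [2 * |x| * |y| * (|x| * |y| - p)]. *)
  have : 0 <= \sum_(i < n)
      (l2norm y * cabs (x i 0) - l2norm x * cabs (y i 0)) ^+ 2.
    by rewrite sumr_ge0 // => i _; exact: sqr_ge0.
  under eq_bigr => i _ do rewrite sqrrB !exprMn -mulr_natl.
  rewrite big_split sumrB /= -!mulr_sumr -!sqr_l2norm.
  rewrite (eq_bigr (fun i => l2norm x * l2norm y *
    (cabs (x i 0) * cabs (y i 0)))); last by move=> i _; ring.
  rewrite -mulr_sumr -/p => h.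
  rewrite -subr_ge0 -(pmulr_rge0 _ (mulr_gt0 xgt0 ygt0)).
  move: h; nra.
rewrite -ler_sqr ?nnegrE ?addr_ge0 ?l2norm_ge0 // sqr_l2norm.
rewrite sqrrD !sqr_l2norm.
apply: (@le_trans _ _ (\sum_(i < n) (cabs (x i 0) + cabs (y i 0)) ^+ 2)).
  apply: ler_sum => i _; rewrite mxE ler_sqr ?nnegrE ?addr_ge0 ?cabs_ge0 //.
  exact: cabsD.
under eq_bigr => i _ do rewrite sqrrD.
rewrite 2!big_split /= lerD2r lerD2l sumrMnl -/p.
by rewrite lerMn2r CS.
Qed.

Lemma l2norm_sum n (I : Type) (r : seq I) (F : I -> 'cV[R[i]]_n) :
  l2norm (\sum_(i <- r) F i) <= \sum_(i <- r) l2norm (F i).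
Proof.
elim/big_rec2: _ => [|i b x _ h]; first by rewrite l2norm0.
by rewrite (le_trans (l2normD _ _)) // lerD2l.
Qed.

Lemma sqr_l2norm_col_mx n m (x : 'cV[R[i]]_n) (y : 'cV[R[i]]_m) :
  l2norm (col_mx x y) ^+ 2 = l2norm x ^+ 2 + l2norm y ^+ 2.
Proof.
rewrite !sqr_l2norm big_split_ord /=; congr (_ + _); apply: eq_bigr => i _.
  by rewrite col_mxEu.
by rewrite col_mxEd.
Qed.

(** Turns identities between squared norms into matrix algebra with adjoints. *)
Lemma l2norm_adjmx n (x : 'cV[R[i]]_n) :
  ((l2norm x ^+ 2)%:C)%C = (x^t* *m x) 0 0.
Proof.
rewrite sqr_l2norm rmorph_sum mxE; apply: eq_bigr => i _.
by rewrite !mxE rmorphXn /= real_cabs normCK mulrC.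
Qed.

End EuclideanNorm.

(** * Operator norm: the matrix-norm axioms on scalar matrices, and partial isometries *)

Section OperatorNorm.
Variable R : realType.
Implicit Types n : nat.

Lemma l2norm_le_opnorm1 n (S : 'M[R[i]]_n) (x : 'cV[R[i]]_n) :
  l2norm x <= 1 -> l2norm (S *m x) <= opnorm S.
Proof.
move=> x1; apply: ub_le_sup; last by exists x.
(* The [sup] is meaningful only for a bounded set. Here [S *m y] combines the columns of [S] with
   coefficients of modulus at most 1, so the sum of the column norms is a bound. *)
exists (\sum_(j < n) l2norm (col j S)) => _ [y [y1 ->]].
have -> : S *m y = \sum_(j < n) y j 0 *: col j S.
  apply/matrixP => i j; rewrite mxE summxE ord1; apply: eq_bigr => k _.
  by rewrite !mxE mulrC.
apply: le_trans (l2norm_sum _ _) _; apply: ler_sum => j _.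
rewrite l2normZ ler_piMl ?l2norm_ge0 //.
exact: le_trans (cabs_le_l2norm _ _) y1.
Qed.

Lemma opnorm_ge0 n (S : 'M[R[i]]_n) : 0 <= opnorm S.
Proof.
rewrite -(l2norm0 R n) -[X in l2norm X](mulmx0 1 S).
by apply: l2norm_le_opnorm1; rewrite l2norm0.
Qed.

Lemma l2norm_mulmx_le n (S : 'M[R[i]]_n) (x : 'cV[R[i]]_n) :
  l2norm (S *m x) <= opnorm S * l2norm x.
Proof.
have [/l2norm_eq0 -> | x0] := eqVneq (l2norm x) 0.
  by rewrite mulmx0 l2norm0 mulr0.
have xgt0 : 0 < l2norm x by rewrite lt_def x0 l2norm_ge0.
rewrite -ler_pdivrMr //.
have ci : cabs ((l2norm x)^-1%:C)%C = (l2norm x)^-1.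
  by rewrite cabs_real ?invr_ge0 ?l2norm_ge0.
rewrite mulrC -ci -l2normZ scalemxAr; apply: l2norm_le_opnorm1.
by rewrite l2normZ ci mulVf.
Qed.

Lemma opnorm_le n (S : 'M[R[i]]_n) (c : R) : 0 <= c ->
  (forall x : 'cV[R[i]]_n, l2norm (S *m x) <= c * l2norm x) -> opnorm S <= c.
Proof.
move=> c0 h; apply: ge_sup.
  by exists (l2norm (S *m 0)); exists 0; rewrite l2norm0 ler01.
move=> _ [x [x1 ->]]; apply: le_trans (h x) _.
by rewrite ler_piMr.
Qed.

Lemma opnorm_eq0 n (S : 'M[R[i]]_n) : opnorm S = 0 -> S = 0.
Proof.
move=> S0; apply/matrixP => i j; have := l2norm_mulmx_le S (delta_mx j 0).
rewrite S0 mul0r [RHS]mxE => h; apply: cabs0_eq0; apply/eqP.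
rewrite eq_le cabs_ge0 andbT (le_trans _ h) //.
by rewrite -colE (le_trans _ (cabs_le_l2norm _ i)) // mxE.
Qed.

Lemma opnormD n (S T : 'M[R[i]]_n) : opnorm (S + T) <= opnorm S + opnorm T.
Proof.
apply: opnorm_le => [|x]; first by rewrite addr_ge0 ?opnorm_ge0.
by rewrite mulmxDl mulrDl (le_trans (l2normD _ _)) // lerD ?l2norm_mulmx_le.
Qed.

Lemma opnormM n (S T : 'M[R[i]]_n) : opnorm (S *m T) <= opnorm S * opnorm T.
Proof.
apply: opnorm_le => [|x]; first by rewrite mulr_ge0 ?opnorm_ge0.
rewrite -mulmxA -mulrA (le_trans (l2norm_mulmx_le _ _)) //.
by rewrite ler_wpM2l ?opnorm_ge0 ?l2norm_mulmx_le.
Qed.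

Lemma opnormZ n (c : R[i]) (S : 'M[R[i]]_n) :
  opnorm (c *: S) = cabs c * opnorm S.
Proof.
have le d (T : 'M[R[i]]_n) : opnorm (d *: T) <= cabs d * opnorm T.
  apply: opnorm_le => [|x]; first by rewrite mulr_ge0 ?cabs_ge0 ?opnorm_ge0.
  by rewrite -scalemxAl l2normZ -mulrA ler_wpM2l ?cabs_ge0 ?l2norm_mulmx_le.
have [-> | c0] := eqVneq c 0.
  apply/eqP; rewrite eq_le le cabs0 mul0r scale0r opnorm_ge0 //.
apply/eqP; rewrite eq_le le /=.
have cc : cabs c * cabs c^-1 = 1.
  by rewrite -cabsM mulfV // -[1]/((1 : R)%:C%C) cabs_real.
(* The reverse inequality is [le] for the scalar [c^-1] and the matrix [c *: S]. *)
rewrite -[X in _ * opnorm X](scalerK c0).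
by rewrite -[leRHS]mul1r -cc -mulrA ler_wpM2l ?cabs_ge0.
Qed.

(** Padding a vector with zeros preserves its norm, and dropping its lower part does not increase
    it; each fact gives one inequality. *)
Lemma opnorm_dsum0 n m (S : 'M[R[i]]_n) :
  opnorm (block_mx S 0 0 (0 : 'M_m)) = opnorm S.
Proof.
have col0 (k : nat) (x : 'cV[R[i]]_k) : l2norm (col_mx x (0 : 'cV_m)) = l2norm x.
  apply/eqP; rewrite -(@eqrXn2 _ 2) ?l2norm_ge0 // sqr_l2norm_col_mx l2norm0.
  by rewrite expr0n addr0.
apply/eqP; rewrite eq_le; apply/andP; split; apply: opnorm_le => [|x];
  rewrite ?opnorm_ge0 //.
- rewrite -[x]vsubmxK mul_block_col !mul0mx !addr0 col0.
  apply: le_trans (l2norm_mulmx_le _ _) _; rewrite ler_wpM2l ?opnorm_ge0 //.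
  rewrite -ler_sqr ?nnegrE ?l2norm_ge0 // sqr_l2norm_col_mx.
  by rewrite lerDl sqr_ge0.
- rewrite -(col0 _ (S *m x)) -(col0 _ x).
  have := l2norm_mulmx_le (block_mx S 0 0 (0 : 'M_m)) (col_mx x 0).
  by rewrite mul_block_col !mul0mx !addr0.
Qed.

Lemma adjmxM m n p (A : 'M[R[i]]_(m, n)) (B : 'M[R[i]]_(n, p)) :
  (A *m B)^t* = B^t* *m A^t*.
Proof. by rewrite trmx_mul map_mxM. Qed.

Lemma adjmxK m n (A : 'M[R[i]]_(m, n)) : A^t*^t* = A.
Proof. by apply/matrixP => i j; rewrite !mxE conjCK. Qed.

(* |x|^2 - |Tx|^2 = |x - T^* T x|^2 when T is a partial isometry. *)
Lemma opnorm_partial_isometry n (T : 'M[R[i]]_n) :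
  T *m T^t* *m T = T -> opnorm T <= 1.
Proof.
move=> hT; apply: opnorm_le => // x; rewrite mul1r.
rewrite -ler_sqr ?nnegrE ?l2norm_ge0 // -subr_ge0.
suff -> : l2norm x ^+ 2 - l2norm (T *m x) ^+ 2 =
  l2norm (x - T^t* *m (T *m x)) ^+ 2 by exact: sqr_ge0.
apply: complexI; rewrite rmorphB /= !l2norm_adjmx.
have -> : (x - T^t* *m (T *m x))^t* = x^t* - x^t* *m T^t* *m T.
  by rewrite linearB map_mxB /= !adjmxM adjmxK.
rewrite mulmxBl !mulmxBr adjmxM !mulmxA.
have -> : x^t* *m T^t* *m T *m T^t* *m T = x^t* *m T^t* *m T.
  by rewrite -2!(mulmxA (x^t* *m T^t*)) hT.
by rewrite !mxE; ring.
Qed.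

End OperatorNorm.

(** * Contractions from partial isometries, and the singular value decomposition *)

Section SingularValues.
Variable R : realType.
Implicit Types n : nat.

Lemma opnorm_unitary n (U : 'M[R[i]]_n) : U *m U^t* = 1%:M -> opnorm U <= 1.
Proof. by move=> UU; apply: opnorm_partial_isometry; rewrite UU mul1mx. Qed.

Lemma partial_isometry_adj n (T : 'M[R[i]]_n) :
  T *m T^t* *m T = T -> T^t* *m T^t*^t* *m T^t* = T^t*.
Proof. by move=> hT; rewrite -!adjmxM mulmxA hT. Qed.

(** Matrix units are partial isometries, the adjoint of [delta_mx i j] being [delta_mx j i]. *)
Lemma opnorm_delta_mx n (i j : 'I_n) : opnorm (delta_mx i j : 'M[R[i]]_n) <= 1.
Proof.
apply: opnorm_partial_isometry.
have -> : (delta_mx i j : 'M[R[i]]_n)^t* = delta_mx j i.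
  by apply/matrixP => k l; rewrite !mxE andbC conjC_nat.
by rewrite !mul_delta_mx.
Qed.

(** This is the summand of [trnorm], so [trnorm a] is convertible to the sum of these values. *)
Definition singular_value n (a : 'M[R[i]]_n) (i : 'I_n) : R :=
  Num.sqrt (complex.Re (spectral_diag (a^t* *m a) 0 i)).

(* [P] diagonalizes [a^* a]; the columns of [a P^*] are orthogonal, with the
   singular values as lengths, and [W] normalizes the nonzero ones. *)
Lemma singular_value_decomposition n (a : 'M[R[i]]_n) :
  let D := diag_mx (\row_i (singular_value a i)%:C%C) in
  exists W P : 'M[R[i]]_n,
    [/\ a = W *m D *m P, P *m P^t* = 1%:M, W *m W^t* *m W = W
      & W^t* *m W *m D = D].
Proof.
move=> D; pose A := a^t* *m a; pose P := spectralmx A; pose d := spectral_diag A.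
have PP : P *m P^t* = 1%:M by apply/unitarymxP; exact: spectral_unitarymx.
have P'P : P^t* *m P = 1%:M by exact: mulmx1C.
(* The spectral theorem applies since [A] is Hermitian, hence normal. *)
have defA : A = P^t* *m diag_mx d *m P.
  rewrite -(invmx_unitary (spectral_unitarymx A)); apply/orthomx_spectralP.
  by apply/normalmxP; rewrite /A adjmxM adjmxK.
pose B := a *m P^t*; pose s i := singular_value a i.
have BB : B^t* *m B = diag_mx d.
  rewrite /B adjmxM adjmxK mulmxA -(mulmxA P) -/A defA !mulmxA PP mul1mx.
  by rewrite -mulmxA PP mulmx1.
have sE i : l2norm (col i B) = s i.
  (* The eigenvalue is the squared length of a column of [B], so taking the real part loses nothing
     and the square root returns the length. *)
  rewrite /s /singular_value -/A -/d.
  have -> : d 0 i = (l2norm (col i B) ^+ 2)%:C%C.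
    rewrite l2norm_adjmx; transitivity (diag_mx d i i).
      by rewrite mxE eqxx mulr1n.
    by rewrite -BB !mxE; apply: eq_bigr => k _; rewrite !mxE.
  by rewrite /= sqrtr_sqr ger0_norm ?l2norm_ge0.
have dE i : d 0 i = (s i)%:C%C ^+ 2.
  rewrite -sE -rmorphXn /= l2norm_adjmx; transitivity (diag_mx d i i).
    by rewrite mxE eqxx mulr1n.
  by rewrite -BB !mxE; apply: eq_bigr => k _; rewrite !mxE.
(* Since [0^-1 = 0], a zero singular value gives a zero column of [W]; thus [W^t* *m W] is diagonal
   with entries 0 or 1. *)
pose I := diag_mx (\row_i ((s i)^-1)%:C%C).
have adjI : I^t* = I.
  apply/matrixP => i j; rewrite !mxE eq_sym.
  have [-> | _] := eqVneq i j; last by rewrite !mulr0n conjC0.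
  by rewrite !mulr1n conj_Creal // ger0_real // ler0c invr_ge0 sqrtr_ge0.
pose W := B *m I.
have WW : W^t* *m W = diag_mx (\row_i ((s i)^-1 * s i)%:C%C).
  rewrite /W adjmxM adjI mulmxA -(mulmxA I) BB !mulmx_diag.
  congr diag_mx; apply/rowP => i; rewrite !mxE dE -!rmorphXn -!rmorphM /=.
  congr (_%:C)%C; have [-> | s0] := eqVneq (s i) 0; first by rewrite invr0 !mul0r.
  by field.
exists W, P; split; [| exact: PP | |].
- have -> : W *m D = B; last by rewrite /B -mulmxA P'P mulmx1.
  rewrite /W /D -mulmxA mulmx_diag; apply/matrixP => i j.
  rewrite mul_mx_diag !mxE -rmorphM /= -/(s j).
  (* Where [s j = 0], column [j] of [B] has length 0, so both sides vanish. *)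
  have [s0 | s0] := eqVneq (s j) 0; last by rewrite mulVf // mulr1.
  have /l2norm_eq0/colP/(_ i) : l2norm (col j B) = 0 by rewrite sE.
  by rewrite !mxE => ->; rewrite mul0r.
- rewrite -mulmxA WW /W -mulmxA mulmx_diag; congr (_ *m diag_mx _).
  apply/rowP => i; rewrite !mxE -rmorphM /=; congr (_%:C)%C.
  have [-> | s0] := eqVneq (s i) 0; first by rewrite invr0 !mul0r.
  by field.
- rewrite WW /D mulmx_diag; congr diag_mx.
  apply/rowP => i; rewrite !mxE -rmorphM /= -/(s i); congr (_%:C)%C.
  have [-> | s0] := eqVneq (s i) 0; first by rewrite mulr0.
  by field.
Qed.

End SingularValues.

(** * Estimates in a matricially normed space, and the scalar example *)

Section MatrixNorm.
Variable R : realType.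
Implicit Types (E : matNormedSpace R) (n : nat).

(** Multiplying by matrix units on both sides moves the entry to the upper left corner and kills the
    rest, at no cost in norm by Axiom 2; Axiom 1 then removes the zero blocks. *)
Lemma mxnorm_entry_le E n (w : 'M[E]_n) k :
  mxnorm (const_mx (w k k) : 'M[E]_1) <= mxnorm w.
Proof.
(* The index [k] excludes size 0, and [n.+1] is convertible to the block size [1 + n]. *)
case: n w k => [|n] w k; first by case: k.
rewrite -(mxnorm_dsum0 n).
have -> : block_mx (const_mx (w k k) : 'M_1) 0 0 (0 : 'M_n) =
    ract (lact (delta_mx 0 k) w) (delta_mx k 0).
  apply/matrixP => i j.
  have -> : ract (lact (delta_mx 0 k) w) (delta_mx k 0) i j =
      (j == 0)%:R *: ((i == 0)%:R *: w k k).
    rewrite mxE (bigD1 k) //= big1 ?addr0 => [|l lk]; last first.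
      by rewrite !mxE (negPf lk) scale0r.
    rewrite !mxE eqxx (bigD1 k) //= big1 ?addr0 => [|l lk]; last first.
      by rewrite !mxE (negPf lk) andbF scale0r.
    by rewrite !mxE eqxx andbT.
  have l0 (i' : 'I_1) : (lshift n i' == 0 :> 'I_n.+1) by rewrite ord1; exact/eqP/val_inj.
  have r0 (i' : 'I_n) : (rshift 1 i' == 0 :> 'I_n.+1) = false by [].
  case: (@split_ordP 1 n i) => i' ->; case: (@split_ordP 1 n j) => j' ->.
  - by rewrite block_mxEul mxE !l0 !scale1r.
  - by rewrite block_mxEur mxE r0 scale0r.
  - by rewrite block_mxEdl mxE r0 scale0r scaler0.
  - by rewrite block_mxEdr mxE r0 scale0r.
apply: le_trans (mxnorm_ract _ _) _.
rewrite -[leRHS]mulr1 ler_pM ?mxnorm_ge0 ?opnorm_ge0 ?opnorm_delta_mx //.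
apply: le_trans (mxnorm_lact _ _) _.
by rewrite ler_piMl ?mxnorm_ge0 ?opnorm_delta_mx.
Qed.

Lemma mxnorm_lact_le1 E n (S : 'M[R[i]]_n) (u : 'M[E]_n) :
  opnorm S <= 1 -> mxnorm u <= 1 -> mxnorm (lact S u) <= 1.
Proof.
move=> S1 u1; apply: le_trans (mxnorm_lact _ _) _.
exact: (mulr_ile1 (opnorm_ge0 _) (mxnorm_ge0 _) S1 u1).
Qed.

Lemma mxnorm_ract_le1 E n (u : 'M[E]_n) (S : 'M[R[i]]_n) :
  mxnorm u <= 1 -> opnorm S <= 1 -> mxnorm (ract u S) <= 1.
Proof.
move=> u1 S1; apply: le_trans (mxnorm_ract _ _) _.
exact: (mulr_ile1 (mxnorm_ge0 _) (opnorm_ge0 _) u1 S1).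
Qed.

Lemma mxnorm_const_sum E n (s : 'I_n -> R) (x : 'I_n -> E) :
  (forall k, 0 <= s k) -> (forall k, mxnorm (const_mx (x k) : 'M[E]_1) <= 1) ->
  mxnorm (const_mx (\sum_k (s k)%:C%C *: x k) : 'M[E]_1) <= \sum_k s k.
Proof.
move=> s0 x1; elim/big_rec2: _ => [|k b y _ h].
  (* The norm of zero comes from homogeneity with the scalar 0. *)
  rewrite (_ : const_mx 0 = mxscale 0 (0 : 'M[E]_1)).
    by rewrite mxnormZ cabs0 mul0r.
  by apply/matrixP => i j; rewrite !mxE scale0r.
rewrite (_ : const_mx _ = mxscale (s k)%:C%C (const_mx (x k)) + const_mx y).
  apply: le_trans (mxnormD _ _) _; rewrite lerD // mxnormZ cabs_real //.
  by rewrite ler_piMr.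
by apply/matrixP => i j; rewrite !mxE.
Qed.

(** This is cyclicity of the trace with entries of [v] in [E]: tr(W diag(s) P v) = tr(diag(s) P v
    W). *)
Lemma mxfun_factor E n (v : 'M[E]_n) (W P : 'M[R[i]]_n) (s : 'rV[R[i]]_n) :
  mxfun v (W *m diag_mx s *m P) =
  \sum_k s 0 k *: (lact P (ract v W)) k k.
Proof.
rewrite /mxfun.
under [RHS]eq_bigr => k _.
  rewrite mxE scaler_sumr.
  under eq_bigr => i _ do rewrite mxE scaler_sumr scaler_sumr.
  over.
rewrite [RHS]exchange_big /=; apply: eq_bigr => i _.
rewrite [RHS]exchange_big /=; apply: eq_bigr => j _.
rewrite mxE scaler_suml; apply: eq_bigr => k _.
by rewrite mul_mx_diag !mxE !scalerA; congr (_ *: _); ring.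
Qed.

(** Closed with [Defined] so that its [mxnorm] reduces to [opnorm], which the lower bound for
    [hatnorm] relies on. *)
Definition scalar_mns : matNormedSpace R.
Proof.
apply: (@MatNormedSpace R R[i]^o (fun n u => @opnorm R n u)).
- by move=> n u; exact: opnorm_ge0.
- by move=> n u; exact: opnorm_eq0.
- by move=> n u w; exact: opnormD.
- move=> n c u; rewrite -opnormZ; congr opnorm.
  by apply/matrixP => i j; rewrite !mxE.
- by move=> n m u; exact: opnorm_dsum0.
- move=> n S u; apply: le_trans (opnormM _ _); rewrite le_eqVlt; apply/orP; left.
  apply/eqP; congr opnorm; apply/matrixP => i j; rewrite !mxE.
  by apply: eq_bigr.
- move=> n u S; apply: le_trans (opnormM _ _); rewrite le_eqVlt; apply/orP; left.
  apply/eqP; congr opnorm; apply/matrixP => i j; rewrite !mxE.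
  by apply: eq_bigr => k _; rewrite mulrC.
Defined.

Lemma mxfun_scalar n (v a : 'M[R[i]]_n) :
  mxfun (v : 'M[scalar_mns]_n) a = \tr (a *m v).
Proof.
rewrite /mxfun exchange_big; apply: eq_bigr => j _; rewrite mxE.
by apply: eq_bigr.
Qed.

Lemma cabs_le_opnorm1 (z : R[i]) : cabs z <= opnorm (const_mx z : 'M_1).
Proof.
have := l2norm_mulmx_le (const_mx z : 'M_1) 1%:M.
have -> : l2norm (1%:M : 'cV[R[i]]_1) = 1.
  apply/eqP; rewrite -(@eqrXn2 _ 2) ?l2norm_ge0 // sqr_l2norm big_ord1 mxE eqxx.
  by rewrite -[1%:R]/((1 : R)%:C%C) cabs_real.
rewrite mulr1 mulmx1 => h; apply: le_trans h.
by rewrite (le_trans _ (cabs_le_l2norm _ 0)) // mxE.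
Qed.

End MatrixNorm.

Theorem theorem6 (R : realType) (n : nat) (hn : (0 < n)%N) (a : 'M[R[i]]_n) :
  hatnorm (const_mx a : 'M['M[R[i]]_n]_1) = ((trnorm a)%:E)%E.
Proof.
have [W [P [aE PP WW WD]]] := singular_value_decomposition a.
have P1 : opnorm P <= 1 by exact: opnorm_unitary.
have P'1 : opnorm (P^t*) <= 1.
  by apply/opnorm_unitary; rewrite adjmxK; exact: mulmx1C.
have W1 : opnorm W <= 1 by exact: opnorm_partial_isometry.
have W'1 : opnorm (W^t*) <= 1.
  by apply/opnorm_partial_isometry/partial_isometry_adj.
apply/eqP; rewrite eq_le; apply/andP; split.
  apply/ge_ereal_sup => _ [E [v [v1 ->]]]; rewrite lee_fin.
  (* Only the [a] inside [mxfun] is factored; the one in [trnorm a] must stay, to match the sum of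
     the coefficients. *)
  rewrite /amplification map_const_mx [in mxfun v a]aE mxfun_factor.
  under eq_bigr => k _ do rewrite mxE.
  apply: mxnorm_const_sum => k; first exact: sqrtr_ge0.
  apply: le_trans (mxnorm_entry_le (lact P (ract v W)) k) _.
  exact: mxnorm_lact_le1 P1 (mxnorm_ract_le1 v1 W1).
apply: le_ereal_sup_tmp.
pose v : 'M[R[i]]_n := P^t* *m W^t*.
exists (opnorm (const_mx (mxfun (v : 'M[scalar_mns R]_n) a) : 'M[R[i]]_1))%:E.
  exists (scalar_mns R), v; split; last by rewrite /amplification map_const_mx.
  apply: le_trans (opnormM _ _) _.
  exact: (mulr_ile1 (opnorm_ge0 _) (opnorm_ge0 _) P'1 W'1).
rewrite lee_fin (le_trans _ (cabs_le_opnorm1 _)) // mxfun_scalar.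
have -> : \tr (a *m v) = (trnorm a)%:C%C.
  rewrite /v {1}aE mulmxA -(mulmxA _ P) PP mulmx1 mxtrace_mulC mulmxA WD.
  rewrite mxtrace_diag rmorph_sum; apply: eq_bigr => k _.
  by rewrite mxE.
by rewrite cabs_real // sumr_ge0 // => k _; exact: sqrtr_ge0.
Qed.
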